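(* Let $d\ge2$ and let $(X_n)$ be a null recurrent rotor walk on $\mathbb{T}_d$, i.e. $\mathbb{E}[\rho(v)]=d-1$ and $r_{d-1}<1$, with i.i.d. random initial configuration. Let $\tau_0=0$ and $\tau_k=\inf\{n>\tau_{k-1}: X_n=o\}$ for $k\ge1$ (these are almost surely finite). Then $$\lim_{k\to\infty}\frac{|R_{\tau_k}|}{\tau_k}=\frac12\quad\text{almost surely}.$$
   Context: Fix an integer $d\ge2$. Let $\widetilde{\mathbb{T}}_d$ be the rooted tree with root $r$ in which every vertex has exactly $d$ children, and let $\mathbb{T}_d$ be $\widetilde{\mathbb{T}}_d$ together with an extra vertex $o$ (the sink) joined by an edge to $r$. For $v\in\widetilde{\mathbb{T}}_d$ its $d+1$ neighbours are labelled $v^{(0)},v^{(1)},\dots,v^{(d)}$, where $v^{(0)}$ is the parent of $v$ (with $r^{(0)}=o$) and $v^{(1)},\dots,v^{(d)}$ are the children of $v$ in a fixed order. A rotor configuration is a map $\rho:\widetilde{\mathbb{T}}_d\to\{0,1,\dots,d\}$. The rotor walk $(X_n)_{n\ge0}$ with initial configuration $\rho_0=\rho$ starts at $X_0=r$; if $X_n=v\in\widetilde{\mathbb{T}}_d$ then $\rho_{n+1}(v)=\rho_n(v)+1 \pmod{d+1}$, $\rho_{n+1}(u)=\rho_n(u)$ for $u\neq v$, and $X_{n+1}=v^{(\rho_{n+1}(v))}$; if $X_n=o$ then $X_{n+1}=r$ and the rotors are unchanged. The initial configuration is random: the $\rho(v)$, $v\in\widetilde{\mathbb{T}}_d$, are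 i.i.d. with $\mathbb{P}[\rho(v)=j]=r_j$ for $j=0,\dots,d$, $\sum_j r_j=1$. The range is $R_n=\{X_0,\dots,X_n\}\setminus\{o\}$ and $|R_n|$ is its cardinality. *)

(* Defs.v *)
From HB Require Import structures.
From mathcomp Require Import all_boot all_order all_algebra.
From mathcomp Require Import all_classical all_reals all_analysis.
Set Implicit Arguments. Unset Strict Implicit. Unset Printing Implicit Defensive.
Import Order.TTheory GRing.Theory Num.Theory.

(* Vertices of the d-ary tree T~_d: words over 'I_d; the root r is [::],
   the children of v are  i :: v  (i : 'I_d, child number i.+1, i.e.
   v^(i+1) = i :: v), and the parent of i :: v is v.
   A point of T_d is an  option (seq 'I_d) : None is the sink o. *)
Definition vertex (d : nat) := seq 'I_d.
Definition point (d : nat) := option (vertex d).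

(* A rotor configuration (during the walk) : values in {0,..,d}. *)
Definition config (d : nat) := vertex d -> nat.

Definition parent (d : nat) (v : vertex d) : point d :=
  if v is _ :: w then Some w else None.

Definition nbr (d : nat) (v : vertex d) (j : nat) : point d :=
  if j == 0 then parent v
  else if @insub nat (fun k => k < d) 'I_d j.-1 is Some i then Some (i :: v)
  else None (* never happens for 0 < j <= d *).

Definition rotor_step (d : nat) (st : point d * config d) : point d * config d :=
  match st.1 with
  | None => (Some [::], st.2)
  | Some v =>
      let r' := (st.2 v).+1 %% d.+1 in
      (nbr v r', fun u => if u == v then r' else st.2 u)
  end.

Fixpoint rotor_state (d : nat) (c0 : config d) (n : nat) : point d * config d :=
  match n with
  | 0 => (Some [::], c0)
  | n.+1 => rotor_step (rotor_state c0 n)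
  end.

Definition rotor_pos (d : nat) (c0 : config d) (n : nat) : point d :=
  (rotor_state c0 n).1.

Definition range_size (d : nat) (c0 : config d) (n : nat) : nat :=
  size (undup (pmap id [seq rotor_pos c0 m | m <- iota 0 n.+1])).

Definition is_kth_return (d : nat) (c0 : config d) (k n : nat) : bool :=
  (rotor_pos c0 n == None) &&
  (count (fun m => rotor_pos c0 m == None) (iota 1 n) == k).

(* Main.v *)
Require Import Defs.
From HB Require Import structures.
From mathcomp Require Import all_boot all_order all_algebra.
From mathcomp Require Import zify ring lra.
From mathcomp Require Import all_classical all_reals all_analysis.
Import Order.TTheory GRing.Theory Num.Theory.
Import numFieldNormedType.Exports.
Local Open Scope classical_set_scope.
Local Open Scope ring_scope.

(* Call the edge from v to its child i :: v bad for c when i < c v, i.e. when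
   the child is not visited before the first return from v to its parent.  The
   range after k excursions is the set R_k of the vertices with fewer than k
   bad edges on their path to the root; after the k-th excursion the rotors are
   0 on R_k and unchanged elsewhere.  Every excursion crosses each edge of its
   range twice, so tau_k = 2 (|R_1| + ... + |R_k|) - 1, and it suffices that
   |R_(k+1)| / |R_k| -> oo.  R_(k+1) adds to R_k one critical Galton-Watson tree
   for each of the |bd R_k| > |R_k| boundary vertices.  Truncated at height h
   such a tree has mean size h and bounded size, so Chebyshev's inequality
   bounds the probability that the new trees contain at most h |bd R_k| / 2
   vertices by C_h / |bd R_k| <= C_h / 2^k, and Borel-Cantelli applies. *)

(** * Good trees and ranges *)

Lemma uniq_flatten_map (I T : eqType) (F : I -> seq T) (s : seq I) :
  uniq s -> (forall i, i \in s -> uniq (F i)) ->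
  (forall i j z, i \in s -> j \in s -> z \in F i -> z \in F j -> i = j) ->
  uniq (flatten [seq F i | i <- s]).
Proof.
elim: s => //= i s IH /andP[nis us] uF dF; rewrite cat_uniq uF ?mem_head //=.
rewrite IH ?andbT //; first last.
- by move=> j k x js ks; apply: dF; rewrite in_cons ?js ?ks orbT.
- by move=> j js; apply: uF; rewrite in_cons js orbT.
apply/hasPn => x /flatten_mapP[j js xj]; apply/negP => xi.
by move: nis; rewrite (dF i j x) ?js ?mem_head// in_cons js orbT.
Qed.

Lemma sum_size_filter (T : Type) (A : pred T) (s : seq T) :
  (\sum_(u <- s) A u = size [seq u <- s | A u])%N.
Proof.
rewrite size_filter -sum1_count [RHS]big_mkcond.
by apply: eq_bigr => u _; case: (A u).
Qed.

Section Combinatorics.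
Local Open Scope nat_scope.
Variable d : nat.
Implicit Types (c : config d) (u v x y : vertex d) (h k n : nat).

Definition upd c v j : config d := fun x => if x == v then j else c x.

Fixpoint bad_edges c x : nat :=
  if x is i :: v then bad_edges c v + (i < c v) else 0.

(** For random rotors this is the family tree of a Galton-Watson process with offspring numbers
    [d - c v], cut to its first [h] generations. *)
Fixpoint good_tree h c v : seq (vertex d) :=
  if h is h'.+1 then
    v :: flatten [seq good_tree h' c (i :: v) | i : 'I_d <- enum 'I_d & c v <= i]
  else [::].

(** Generation [h] of that tree is empty, so that [good_tree h] is the whole tree. Generation 0
    consists of [v], whence [false] at height 0. *)
Fixpoint extinct h c v : bool :=
  if h is h'.+1 then [forall i : 'I_d, (c v <= i) ==> extinct h' c (i :: v)]
  else false.

Fixpoint words n : seq (vertex d) :=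
  if n is n'.+1 then [::] :: [seq i :: v | v <- words n', i <- enum 'I_d]
  else [::].

Lemma mem_words n x : (x \in words n) = (size x < n).
Proof.
elim: n x => [|n IH] [|i v] //=; rewrite in_cons /=.
apply/allpairsP/idP => [[[v' i'] /= [+ _ [_ ->]]]|]; first by rewrite IH.
by move=> lt; exists (v, i); split => //=; rewrite ?IH ?mem_enum.
Qed.

Lemma uniq_words n : uniq (words n).
Proof.
elim: n => //= n IH; apply/andP; split; first by apply/allpairsP => -[[? ?] []].
by apply: allpairs_uniq => //; [exact: enum_uniq|move=> [? ?] [? ?] _ _ /= [-> ->]].
Qed.

Lemma size_words n : 2 <= d -> 2 ^ n <= (size (words n)).+1.
Proof.
move=> d2; elim: n => //= n IH; rewrite size_allpairs size_enum_ord expnS; nia.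
Qed.

Lemma bad_edges_cat c y u : bad_edges c u <= bad_edges c (y ++ u).
Proof. by elim: y => //= i y IH; apply: leq_trans IH (leq_addr _ _). Qed.

Lemma bad_edges_le_size c x : bad_edges c x <= size x.
Proof. by elim: x => //= i v IH; case: (i < c v); lia. Qed.

(** Words grow at the head, so [y ++ v] is a descendant of [v]. Bad edges accumulate along a path,
    hence equal counts at its two ends mean that no edge in between is bad. *)
Lemma good_treeP h c v x :
  reflect (exists2 y, x = y ++ v & (size y < h) && (bad_edges c x == bad_edges c v))
          (x \in good_tree h c v).
Proof.
apply: (iffP idP); elim: h v x => [|h IH] v x //=.
- rewrite in_cons => /orP[/eqP->|]; first by exists [::] => //=; rewrite eqxx.
  move=> /flatten_mapP[i]; rewrite mem_filter => /andP[gi _] /IH [y ->].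
  move=> /andP[ly /eqP e]; exists (rcons y i); rewrite ?cat_rcons //= size_rcons.
  by rewrite ltnS ly e /= ltnNge gi addn0 eqxx.
- by case.
- move=> [y -> /andP[ly /eqP e]]; rewrite in_cons.
  case: (lastP y) ly e => [|y' i]; first by rewrite /= eqxx.
  rewrite size_rcons cat_rcons => ly e; apply/orP; right.
  have := bad_edges_cat c y' (i :: v); rewrite e /= => le.
  have gi : c v <= i by move: le; case: ltnP => //; lia.
  apply/flatten_mapP; exists i; first by rewrite mem_filter gi mem_enum.
  by apply: IH; exists y' => //; rewrite -ltnS ly e /= ltnNge gi addn0 /=.
Qed.

Lemma cat_comparable y z u u' : y ++ u = z ++ u' ->
  (exists t, u = t ++ u') \/ (exists t, u' = t ++ u).
Proof.
elim: y z => [|i y IH] z; first by move=> /= ->; left; exists z.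
case: z => [/= <-|j z [_ /IH]//]; by right; exists (i :: y).
Qed.

Lemma cons_cat_inj y z (i j : 'I_d) v : y ++ i :: v = z ++ j :: v -> i = j.
Proof.
move=> e; have se : size y = size z.
  by have := congr1 size e; rewrite !size_cat /=; lia.
by move/eqP: e; rewrite eqseq_cat // => /andP[_ /eqP[]].
Qed.

Lemma uniq_good_tree h c v : uniq (good_tree h c v).
Proof.
elim: h v => //= h IH v; apply/andP; split.
  apply/flatten_mapP => -[i _ /good_treeP[y /(congr1 size)]].
  by rewrite size_cat /=; lia.
apply: uniq_flatten_map => //; first by rewrite filter_uniq // enum_uniq.
by move=> i j x _ _ /good_treeP[y -> _] /good_treeP[z + _]; apply: cons_cat_inj.
Qed.

Lemma extinctP h c v :
  reflect (forall y, size y = h -> bad_edges c v < bad_edges c (y ++ v))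
          (extinct h c v).
Proof.
apply: (iffP idP); elim: h v => [|h IH] v //=.
- move=> /forallP e y; case: (lastP y) => [//|y' i]; rewrite size_rcons cat_rcons.
  move=> [sy]; have := bad_edges_cat c y' (i :: v); have /implyP := e i.
  rewrite /=; case: ltnP => [_ _|gi /(_ isT) /IH/(_ y' sy)]; first by lia.
  by rewrite /= (ltnNge i) gi addn0.
- by move=> /(_ [::] erefl); rewrite ltnn.
- move=> H; apply/forallP => i; apply/implyP => gi; apply: IH => y sy.
  have := H (rcons y i); rewrite size_rcons sy cat_rcons /= (ltnNge i) gi addn0.
  exact.
Qed.

Lemma bad_edges_ext c c' x : (forall v, size v < size x -> c v = c' v) ->
  bad_edges c x = bad_edges c' x.
Proof.
by elim: x => //= i v IH e; rewrite e // IH // => w lw; rewrite e // ltnS ltnW.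
Qed.

Lemma good_tree_ext h c c' u :
  (forall y, size y < h -> c (y ++ u) = c' (y ++ u)) ->
  good_tree h c u = good_tree h c' u.
Proof.
elim: h u => //= h IH u e; rewrite (e [::]) //; congr (_ :: flatten _).
by apply: eq_map => i; apply: IH => y ly; rewrite -cat_rcons e // size_rcons.
Qed.

Lemma extinct_ext h c c' u :
  (forall y, size y < h -> c (y ++ u) = c' (y ++ u)) ->
  extinct h c u = extinct h c' u.
Proof.
elim: h u => //= h IH u e; rewrite (e [::]) //; apply: eq_forallb => i; congr (_ ==> _).
by apply: IH => y ly; rewrite -cat_rcons e // size_rcons.
Qed.

(** The size of the full [d]-ary tree with [h] generations. *)
Fixpoint max_size h : nat := if h is h'.+1 then (d * max_size h').+1 else 0.

Lemma size_good_treeS h c u : size (good_tree h.+1 c u) =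
  (\sum_(i < d) if c u <= i then size (good_tree h c (i :: u)) else 0).+1.
Proof.
rewrite /= size_flatten /shape -map_comp sumnE big_map big_filter big_enum_cond /=.
by rewrite -big_mkcond.
Qed.

Lemma size_good_tree h c u : size (good_tree h c u) <= max_size h.
Proof.
elim: h u => // h IH u; rewrite size_good_treeS ltnS.
apply: (@leq_trans (\sum_(i < d) max_size h)); last by rewrite sum_nat_const card_ord.
by apply: leq_sum => i _; case: ifP.
Qed.

(** The root, which has no parent in the tree, is the boundary of the empty range. *)
Definition boundary (A : pred (vertex d)) u : bool :=
  ~~ A u && (if u is _ :: v then A v else true).

Definition range_set c k : pred (vertex d) := fun x => bad_edges c x < k.

(** A rotor at or below [u] governs only edges below [u], where the count has already reached [k];
    capping the count at [k] hides the change. *)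
Lemma minn_bad_edges_upd c k u y j x : k <= bad_edges c u ->
  minn k (bad_edges (upd c (y ++ u) j) x) = minn k (bad_edges c x).
Proof.
move=> ku; elim: x => //= i v IH.
case: (leqP k (bad_edges c v)) => [kv|vk]; first by move: IH kv; lia.
rewrite /upd; case: eqP => [e|_]; first by have := bad_edges_cat c y u; rewrite -e; lia.
by move: IH vk; rewrite /upd; lia.
Qed.

Lemma range_set_upd c k u y j : k <= bad_edges c u ->
  range_set (upd c (y ++ u) j) k = range_set c k.
Proof.
move=> ku; apply/funext => x; have := @minn_bad_edges_upd c k u y j x ku.
by rewrite /range_set; lia.
Qed.

Lemma upd_upd c v j : upd (upd c v j) v (c v) = c.
Proof. by apply/funext => x; rewrite /upd; case: eqP => // ->. Qed.

Lemma le_bad_edges_upd c k u y j :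
  (k <= bad_edges (upd c (y ++ u) j) u) = (k <= bad_edges c u).
Proof.
apply/idP/idP => ku.
- by have := @minn_bad_edges_upd _ k u y (c (y ++ u)) u ku; rewrite upd_upd; lia.
- by have := @minn_bad_edges_upd _ k u y j u ku; lia.
Qed.

(** If one of two boundary vertices were strictly below the other, its parent would be at or below
    the other and so have at least [k] bad edges, yet it lies in the range. *)
Lemma boundary_incomparable c k u u' y z :
  boundary (range_set c k) u -> boundary (range_set c k) u' ->
  y ++ u = z ++ u' -> u = u'.
Proof.
wlog [t e] : y z u u' / exists t, u = t ++ u'.
  move=> W bu bu' e; case: (cat_comparable _ _ _ _ e) => h; first exact: W e.
  by apply/esym/(W z y).
rewrite {}e; case: t => // i t; rewrite /boundary /= /range_set -!leqNgt.
by move=> /andP[_ lt] /andP[le _]; have := bad_edges_cat c t u'; lia.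
Qed.

Lemma sum_wordsS (f : vertex d -> nat) n :
  \sum_(u <- words n.+1) f u = f [::] + \sum_(v <- words n) \sum_(i < d) f (i :: v).
Proof.
rewrite big_cons; congr addn; rewrite big_allpairs_dep.
by apply: eq_bigr => v _; rewrite big_enum.
Qed.

(** The range and its boundary together consist of the root and of all children of range
    vertices. *)
Lemma boundary_count c k n : 0 < k -> (forall x, size x = n -> k <= bad_edges c x) ->
  \sum_(u <- words n.+1) boundary (range_set c k) u + \sum_(u <- words n) range_set c k u
  = 1 + d * \sum_(u <- words n) range_set c k u.
Proof.
move=> k0 fin.
have E : \sum_(u <- words n.+1) range_set c k u = \sum_(u <- words n) range_set c k u.
  rewrite !sum_size_filter; apply/perm_size/uniq_perm; rewrite ?filter_uniq ?uniq_words //.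
  move=> x; rewrite !mem_filter !mem_words /range_set; case: (ltngtP (size x) n) => xn.
  - by rewrite (leqW xn).
  - by rewrite (ltnNge (size x)) xn.
  - by rewrite xn ltnSn andbT andbF ltnNge fin.
rewrite -{1}E -big_split /= sum_wordsS /boundary /= /range_set /= k0 /= big_distrr /=.
congr addn; apply: eq_bigr => v _.
rewrite (eq_bigr (fun=> (bad_edges c v < k) : nat)); last first.
  move=> i _; case: (ltnP (bad_edges c v) k); case: leqP => //=; lia.
by rewrite sum_nat_const card_ord.
Qed.

(** The trees hung at different boundary vertices are disjoint by incomparability. The edge into a
    boundary vertex adds at most one bad edge to a count below [k], and the tree adds none, so they
    all lie in the next range. *)
Lemma sum_good_trees c k h n :
  \sum_(u <- words n | boundary (range_set c k) u) size (good_tree h c u) <=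
  \sum_(x <- words (n + h)) range_set c k.+1 x.
Proof.
rewrite sum_size_filter -big_filter.
set s := [seq u <- words n | boundary (range_set c k) u].
have bs u : u \in s -> boundary (range_set c k) u /\ size u < n.
  by rewrite mem_filter mem_words => /andP[].
have -> : \sum_(u <- s) size (good_tree h c u)
    = size (flatten [seq good_tree h c u | u <- s]).
  by rewrite size_flatten /shape -map_comp sumnE big_map.
apply: uniq_leq_size.
  apply: uniq_flatten_map => [|u _|]; first by rewrite filter_uniq // uniq_words.
    exact: uniq_good_tree.
  move=> u u' x /bs[bu _] /bs[bu' _] /good_treeP[y -> _] /good_treeP[z e _].
  exact: boundary_incomparable bu bu' e.
move=> x /flatten_mapP[u /bs[bu su] /good_treeP[y -> /andP[sy /eqP e]]].
rewrite mem_filter mem_words size_cat /range_set e ltnS; apply/andP; split; last by lia.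
case: u bu {su e} => [|i v] //; rewrite /boundary /range_set /= => /andP[_].
by case: (i < c v) => /=; lia.
Qed.

End Combinatorics.

(** * Excursions of the rotor walk *)

Section Walk.
Local Open Scope nat_scope.
Variable d : nat.
Implicit Types (c : config d) (u v x y : vertex d) (h k n : nat) (st : Defs.point d * config d).

(** If level [n] lies outside the range of [k], let [H] bound the extinction heights of its finitely
    many vertices: every path going [H] levels further meets one more bad edge. *)
Lemma range_finite c : (forall u, exists h, extinct d h c u) ->
  forall k, exists n, forall x, size x = n -> k <= bad_edges d c x.
Proof.
move=> ext; elim=> [|k [n nk]]; first by exists 0.
have {}ext u : exists h, extinct d h c u := ext u.
pose H := \max_(u <- words d n.+1) ex_minn (ext u).
exists (H + n) => z sz; have sy : size (drop H z) = n by rewrite size_drop; lia.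
have : ex_minn (ext (drop H z)) <= H by rewrite /H leq_bigmax_seq // mem_words sy.
case: ex_minnP => h /extinctP eh _ hH.
rewrite -(cat_take_drop H z) -(cat_take_drop (H - h) (take H z)) -catA.
apply: leq_trans (bad_edges_cat _ _ _ _); apply: leq_ltn_trans (nk _ sy) _.
by apply: eh; rewrite size_drop size_take; case: ltnP; lia.
Qed.

Definition trace st n : seq (Defs.point d) :=
  [seq (iter m (@rotor_step d) st).1 | m <- iota 0 n].

Lemma trace_add st m n :
  trace st (m + n) = trace st m ++ trace (iter m (@rotor_step d) st) n.
Proof.
rewrite /trace iotaD map_cat add0n -{2}[m]addn0 iotaDl -map_comp; congr (_ ++ _).
by apply: eq_map => i /=; rewrite addnC iterD.
Qed.

Lemma mem_good_treeS h c v x : (x \in good_tree d h.+1 c v) =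
  (x == v) || [exists i : 'I_d, (c v <= i) && (x \in good_tree d h c (i :: v))].
Proof.
rewrite /= in_cons; congr orb; apply/flatten_mapP/existsP => [[i]|[i /andP[gi xi]]].
  by rewrite mem_filter => /andP[gi _] xi; exists i; rewrite gi.
by exists i; rewrite // mem_filter gi mem_enum.
Qed.

(** The walk explores the good tree depth first. It crosses each of the edges of the tree twice and
    then steps to the parent, which gives twice the size minus one. Extinction ensures that the
    truncation cuts nothing off. *)
Lemma excursion h c v : (forall x, c x <= d) -> extinct d h c v ->
  exists t : seq (vertex d), [/\ t =i good_tree d h c v,
    trace (Some v, c) (size (good_tree d h c v)).*2.-1 = map Some t &
    iter (size (good_tree d h c v)).*2.-1 (@rotor_step d) (Some v, c) =
      (parent v, fun x => if x \in good_tree d h c v then 0 else c x)].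
Proof.
elim: h c v => // h IH c v.
(* Induction on d - c v: once the child number c v + 1 has been explored, the
   walk is back in v and it remains to explore the good tree of v for the rotor
   c v + 1. *)
move: {2}(d - c v) (erefl (d - c v)) => k.
elim: k c => [|k IHk] c dk cd e.
  have cv : c v = d by apply/eqP; rewrite eqn_leq cd -subn_eq0 dk.
  have -> : good_tree d h.+1 c v = [:: v].
    rewrite /= (eq_filter (a2 := pred0)) ?filter_pred0 // => i.
    by rewrite cv leqNgt ltn_ord.
  exists [:: v]; split => //=.
  (* The rotor [d] wraps round to 0 and points to the parent. *)
  rewrite /rotor_step /= cv modnn /nbr eqxx; congr pair; apply/funext => x.
  by rewrite mem_seq1.
have jd : c v < d by lia.
(* Letters start at 0 and child numbers at 1, so the rotor value [(c v).+1] leads to the letter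
   [c v]. *)
pose i0 := Ordinal jd; pose c1 := upd d c v (c v).+1.
have step1 : rotor_step (Some v, c) = (Some (i0 :: v), c1).
  rewrite /rotor_step /= modn_small ?ltnS // /nbr /=; congr pair.
  by rewrite insubT.
have c1E i y : c1 (y ++ i :: v) = c (y ++ i :: v).
  by rewrite /c1 /upd; case: eqP => // /(congr1 size); rewrite size_cat /=; lia.
have g1E i : good_tree d h c1 (i :: v) = good_tree d h c (i :: v).
  by apply: good_tree_ext => y _.
have cd1 x : c1 x <= d by rewrite /c1 /upd; case: ifP.
have e1 : extinct d h c1 (i0 :: v).
  rewrite (@extinct_ext _ _ _ c) => [|y _]; last exact: c1E.
  by move/forallP: e => /(_ i0) /implyP; apply.
have [t1 []] := IH _ _ cd1 e1; rewrite g1E => mt1 tr1 it1.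
pose c2 x := if x \in good_tree d h c (i0 :: v) then 0 else c1 x.
have vN i : v \notin good_tree d h c (i :: v).
  by apply/negP => /good_treeP[y /(congr1 size)]; rewrite size_cat /=; lia.
have c2v : c2 v = (c v).+1 by rewrite /c2 (negbTE (vN _)) /c1 /upd eqxx.
have c2E i y : i != i0 -> c2 (y ++ i :: v) = c (y ++ i :: v).
  rewrite /c2 c1E; case: ifP => // /good_treeP[z + _] /eqP.
  by move=> /cons_cat_inj ->.
have cd2 x : c2 x <= d by rewrite /c2; case: ifP.
have ne0 (i : 'I_d) : c v < i -> i != i0 by apply: contraTneq => ->; rewrite ltnn.
have e2 : extinct d h.+1 c2 v.
  apply/forallP => i; apply/implyP; rewrite c2v => ci.
  rewrite -/(extinct d h c2 (i :: v)) (@extinct_ext _ _ _ c) => [|y _].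
    by move/forallP: e => /(_ i) /implyP; apply; apply: ltnW.
  by apply: c2E; apply: ne0.
have g2E (i : 'I_d) : c v < i -> good_tree d h c2 (i :: v) = good_tree d h c (i :: v).
  by move=> ci; apply: good_tree_ext => y _; apply: c2E; apply: ne0.
have dk2 : d - c2 v = k by rewrite c2v; lia.
have [t2 [mt2 tr2 it2]] := IHk c2 dk2 cd2 e2.
have mE x : (x \in good_tree d h.+1 c v) =
    (x \in good_tree d h c (i0 :: v)) || (x \in good_tree d h.+1 c2 v).
  rewrite !mem_good_treeS orbCA; congr orb.
  apply/existsP/orP => [[i /andP[ci xi]]|[xi|/existsP[i]]].
  - move: ci; rewrite leq_eqVlt => /orP[/eqP ci|ci].
      by left; have -> : i0 = i by apply: val_inj.
    by right; apply/existsP; exists i; rewrite c2v ci g2E.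
  - by exists i0; rewrite leqnn.
  - by rewrite c2v => /andP[ci]; rewrite g2E // => xi; exists i; rewrite xi ltnW.
have sE : size (good_tree d h.+1 c v) =
    size (good_tree d h c (i0 :: v)) + size (good_tree d h.+1 c2 v).
  rewrite !size_good_treeS addnS c2v (bigD1 i0) //= leqnn; congr (_ + _).+1.
  rewrite [RHS](bigD1 i0) //= ltnn add0n; apply: eq_bigr => i ni.
  rewrite leq_eqVlt; case: eqP => [ci|_ /=].
    by case/eqP: ni; apply: val_inj.
  by case: ifP => // ci; rewrite g2E.
have s1 : 0 < size (good_tree d h c (i0 :: v)) by case: (h) e1.
have s2 : 0 < size (good_tree d h.+1 c2 v) by [].
have -> : (size (good_tree d h.+1 c v)).*2.-1 =
    (1 + (size (good_tree d h c (i0 :: v))).*2.-1)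
     + (size (good_tree d h.+1 c2 v)).*2.-1 by lia.
have it : iter (1 + (size (good_tree d h c (i0 :: v))).*2.-1) (@rotor_step d) (Some v, c)
    = (Some v, c2) by rewrite addnC iterD /= step1 it1.
exists (v :: t1 ++ t2); split.
- move=> x; rewrite mE in_cons mem_cat mt1 mt2 mem_good_treeS.
  by case: (x == v); rewrite ?orbT.
- by rewrite trace_add it trace_add /= step1 tr1 tr2 map_cat.
- rewrite addnC iterD it it2; congr pair; apply/funext => x; rewrite mE /c2.
  case: ifP => [|xN]; first by rewrite orbT.
  rewrite orbF; case: ifP => // _; rewrite /c1 /upd; case: eqP => // xv.
  by move: xN; rewrite xv mem_good_treeS eqxx.
Qed.

Definition zeroed c k : config d := fun x => if range_set d c k x then 0 else c x.

(** An edge leaving a vertex with rotor 0 is never bad. Zeroing the rotors of the range thus removes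
    exactly the first [k] bad edges of each path, and the first range of the new configuration is
    range [k.+1] of the old one. *)
Lemma bad_edges_zeroed c k x : bad_edges d (zeroed c k) x = bad_edges d c x - k.
Proof.
elim: x => //= i v ->; rewrite /zeroed /range_set.
case: (ltnP (bad_edges d c v) k) => bk; last by rewrite addnBAC.
by case: (i < c v); lia.
Qed.

(** * Return times to the sink and the ranges at these times *)

Section Returns.
Variables (c : config d) (N : nat -> nat).
Hypothesis cd : forall x, c x <= d.
Hypothesis finN : forall k x, size x = N k -> k <= bad_edges d c x.

Definition range_card k := \sum_(x <- words d (N k)) range_set d c k x.

(* The time at which the excursion k + 1 leaves the root: tau_k + 1 for k > 0,
   but 0 for k = 0, as the walk starts at the root and not at the sink. *)
Definition restart k := (\sum_(1 <= i < k.+1) range_card i).*2.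

Lemma mem_range_words k x :
  (x \in [seq x <- words d (N k) | range_set d c k x]) = range_set d c k x.
Proof.
rewrite mem_filter mem_words; case xk: (range_set d c k x) => //=.
rewrite ltnNge; apply/negP => Nx; move: xk.
rewrite -(cat_take_drop (size x - N k) x) /range_set => /negP; apply; apply/negP.
rewrite -leqNgt; apply: leq_trans (bad_edges_cat _ _ _ _); apply: finN.
by rewrite size_drop subKn.
Qed.

(** Excursion [k.+1] starts from [zeroed c k], whose good tree at the root is range [k.+1]. It takes
    twice the size of this range minus one steps to the sink, and one more step leads back to the
    root. *)
Lemma restartP k (T := restart k) (tr := trace (Some [::], c) T) :
  [/\ iter T (@rotor_step d) (Some [::], c) = (Some [::], zeroed c k),
      count (pred1 None) tr = k,
      pmap id tr =i range_set d c k &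
      0 < k -> 0 < T /\ (iter T.-1 (@rotor_step d) (Some [::], c)).1 = None].
Proof.
rewrite {}/tr {}/T; elim: k => [|k [itk ctk mtk _]].
  by rewrite /restart big_geq //=; split.
set g := good_tree d (N k.+1) (zeroed c k) [::].
have gE x : (x \in g) = range_set d c k.+1 x.
  apply/good_treeP/idP => [[y _ /andP[_]]|].
    by rewrite bad_edges_zeroed /= subn_eq0 /range_set ltnS.
  move=> xk; exists x; rewrite ?cats0 //.
  move: (mem_range_words k.+1 x); rewrite xk mem_filter xk mem_words /= => ->.
  by rewrite bad_edges_zeroed /= subn_eq0.
have sg : size g = range_card k.+1.
  rewrite /range_card sum_size_filter; apply/perm_size/uniq_perm.
  - exact: uniq_good_tree.
  - by rewrite filter_uniq // uniq_words.
  - by move=> x; rewrite gE mem_range_words.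
have zd x : zeroed c k x <= d by rewrite /zeroed; case: ifP.
have [|t []] := @excursion (N k.+1) (zeroed c k) [::] zd.
  apply/extinctP => y sy; rewrite !bad_edges_zeroed cats0 /= sub0n subn_gt0.
  exact: finN sy.
rewrite -/g sg /= => mt trt itt.
have g0 : 0 < range_card k.+1.
  by rewrite -sg -has_predT; apply/hasP; exists [::] => //; rewrite gE.
have TE : restart k.+1 = restart k + ((range_card k.+1).*2.-1 + 1).
  by rewrite /restart big_nat_recr //=; lia.
have itE : iter (range_card k.+1).*2.-1 (@rotor_step d) (Some [::], zeroed c k)
    = (None, zeroed c k.+1).
  rewrite itt; congr pair; apply/funext => x; rewrite gE /zeroed /range_set.
  by rewrite ltnS; case: ltngtP.
have trE : trace (Some [::], c) (restart k.+1)
    = trace (Some [::], c) (restart k) ++ (map Some t ++ [:: None]).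
  by rewrite TE trace_add itk trace_add itE trt.
split.
- by rewrite TE addnC iterD itk addnC iterD itE.
- rewrite trE !count_cat ctk count_map /= [count _ _](_ : _ = 0) ?addn1 //.
  by apply/eqP; rewrite -leqn0 leqNgt -has_count; apply/hasPn.
- move=> x; rewrite trE !pmap_cat !mem_cat mtk /= orbF.
  rewrite (_ : pmap id (map Some t) = t); last by elim: (t) => //= ? ? ->.
  rewrite mt gE /range_set !unfold_in /= ltnS; lia.
- move=> _; split; first by rewrite TE addn1 addnS.
  by rewrite TE addn1 addnS /= addnC iterD itk itE.
Qed.

Lemma rotor_stateE n : rotor_state c n = iter n (@rotor_step d) (Some [::], c).
Proof. by elim: n => //= n ->. Qed.

Lemma return_time k : 0 < k ->
  is_kth_return c k (restart k).-1 /\ range_size c (restart k).-1 = range_card k.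
Proof.
move=> k0; have [_ ct mt /(_ k0)[T0 pos]] := restartP k.
have trE : [seq rotor_pos c m | m <- iota 0 (restart k)] = trace (Some [::], c) (restart k).
  by apply: eq_map => m; rewrite /rotor_pos rotor_stateE.
split.
  rewrite /is_kth_return /rotor_pos rotor_stateE pos eqxx /=; apply/eqP.
  (* The trace includes time 0, which the count of returns leaves out; the walk is then at the root,
     so both counts agree. *)
  rewrite -[RHS]ct -trE count_map -{2}(prednK T0) /=.
  by apply: eq_count => m.
rewrite /range_size prednK // trE /range_card sum_size_filter; apply/perm_size/uniq_perm.
- exact: undup_uniq.
- by rewrite filter_uniq // uniq_words.
- by move=> x; rewrite mem_undup mt mem_range_words.
Qed.

End Returns.
End Walk.

(** * Averaging over finitely many independent rotors *)

Lemma sum_leq_ord (j n : nat) : (\sum_(i < n) (j <= i) = n - j)%N.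
Proof. by elim: n => [|n IH]; rewrite ?big_ord0 // big_ord_recr /= IH; case: leqP; lia. Qed.

Lemma prod_leq_ord (R : realType) (q : R) (j n : nat) :
  \prod_(i < n) (if (j <= i)%N then q else 1) = q ^+ (n - j).
Proof.
elim: n => [|n IH]; first by rewrite big_ord0.
rewrite big_ord_recr /= IH; case: leqP => jn; first by rewrite subSn // exprSr.
by rewrite mulr1; congr (_ ^+ _); lia.
Qed.

Section Expectation.
Variables (R : realType) (d : nat) (r : nat -> R).
Implicit Types (c : config d) (u v x y : vertex d) (h k n : nat) (F G : config d -> R).

Definition average v F c : R := \sum_(j < d.+1) r j * F (upd d c v j).

(* The conditional expectation of F given that the rotors outside s are those
   of the argument. *)
Definition expect (s : seq (vertex d)) F := foldr average F s.

Definition indep v F := forall c j, F (upd d c v j) = F c.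

Lemma updC c v w i j : v != w -> upd d (upd d c v i) w j = upd d (upd d c w j) v i.
Proof.
move=> vw; apply/funext => x; rewrite /upd; case: (x =P w) => // ->.
by rewrite eq_sym (negbTE vw).
Qed.

Lemma upd_twice c v i j : upd d (upd d c v i) v j = upd d c v j.
Proof. by apply/funext => x; rewrite /upd; case: eqP. Qed.

Lemma averageC v w F : average v (average w F) = average w (average v F).
Proof.
have [->//|vw] := eqVneq v w.
apply/funext => c; rewrite /average.
under eq_bigr do rewrite big_distrr /=.
rewrite exchange_big /=; apply: eq_bigr => i _; rewrite big_distrr /=.
by apply: eq_bigr => j _; rewrite mulrCA updC.
Qed.

Hypothesis r_sum : \sum_(j < d.+1) r j = 1.

Lemma average_indep v F G : indep v F ->
  average v (fun c => F c * G c) = fun c => F c * average v G c.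
Proof.
move=> iF; apply/funext => c; rewrite /average big_distrr /=.
by apply: eq_bigr => j _; rewrite iF mulrCA.
Qed.

Lemma average_id v F : indep v F -> average v F = F.
Proof.
move=> iF; apply/funext => c; rewrite /average.
by under eq_bigr do rewrite iF; rewrite -big_distrl /= r_sum mul1r.
Qed.

Lemma indep_average v F : indep v (average v F).
Proof. by move=> c i; rewrite /average; under eq_bigr do rewrite upd_twice. Qed.

(** Averages commute, and a second average over the same rotor changes nothing. *)
Lemma expect_average v s F : v \in s -> expect s (average v F) = expect s F.
Proof.
elim: s => //= w s IH; rewrite in_cons => /orP[/eqP <-|/IH -> //].
suff -> : expect s (average v F) = average v (expect s F).
  by rewrite average_id //; exact: indep_average.
by elim: (s) => //= u t ->; rewrite averageC.
Qed.

Lemma expect_sum s (I : Type) (l : seq I) (F : I -> config d -> R) :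
  expect s (fun c => \sum_(i <- l) F i c) = fun c => \sum_(i <- l) expect s (F i) c.
Proof.
elim: s => //= v s ->; apply/funext => c; rewrite /average exchange_big /=.
by under eq_bigr do rewrite big_distrr.
Qed.

Lemma expectZ s a F : expect s (fun c => a * F c) = fun c => a * expect s F c.
Proof.
elim: s => //= v s ->; apply/funext => c; rewrite /average big_distrr /=.
by under eq_bigr do rewrite mulrCA.
Qed.

Lemma expectD s F G : expect s (fun c => F c + G c) = fun c => expect s F c + expect s G c.
Proof.
elim: s => //= v s ->; apply/funext => c; rewrite /average -big_split /=.
by under eq_bigr do rewrite mulrDr.
Qed.

Lemma expect_cst s a : expect s (fun=> a) = fun=> a.
Proof. by elim: s => //= v s ->; rewrite average_id. Qed.

Hypothesis r_ge0 : forall j : 'I_d.+1, 0 <= r j.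

Lemma expect_le s F G c : (forall c, F c <= G c) -> expect s F c <= expect s G c.
Proof.
move=> FG; elim: s c => //= v s IH c.
by apply: ler_sum => j _; rewrite ler_wpM2l.
Qed.

(** By [expect_average] the rotor of [v] may be integrated out first, which replaces [g (c v)] by
    its mean. *)
Lemma expect_indep v s F (g : nat -> R) c0 : v \in s -> indep v F ->
  expect s (fun c => F c * g (c v)) c0 = (\sum_(j < d.+1) r j * g j) * expect s F c0.
Proof.
move=> vs iF; rewrite -(@expect_average v) // average_indep //.
rewrite -[RHS]/((fun c => _ * expect s F c) c0) -expectZ; congr (expect s _ c0).
apply/funext => c; rewrite mulrC; congr (_ * _).
by apply: eq_bigr => j _; rewrite /upd eqxx.
Qed.

Hypothesis r_mean : \sum_(j < d.+1) j%:R * r j = (d - 1)%:R.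
Hypothesis d_ge2 : (2 <= d)%N.

(** Criticality: a vertex with rotor [j] has [d - j] good children. *)
Lemma mean_offspring : \sum_(j < d.+1) r j * (d - j)%:R = 1.
Proof.
rewrite (eq_bigr (fun j : 'I_d.+1 => d%:R * r j - j%:R * r j)).
  rewrite sumrB -big_distrr /= r_sum r_mean mulr1 natrB; last by lia.
  by ring.
by move=> j _; rewrite mulrC natrB -1?ltnS // mulrBl.
Qed.

Lemma mean_children : \sum_(i < d) \sum_(j < d.+1) r j * (j <= i)%:R = 1.
Proof.
rewrite exchange_big /= -[RHS]mean_offspring; apply: eq_bigr => j _.
by rewrite -big_distrr /= -natr_sum sum_leq_ord.
Qed.

(** Each of the [h] generations of a critical tree has mean size one. The factor [F] carries the
    induction: it absorbs the indicator that child [i] is good, which ignores all rotors below that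
    child. *)
Lemma expect_good_tree M h u F c0 : (size u + h <= M)%N ->
  (forall y, indep (y ++ u) F) ->
  expect (words d M) (fun c => F c * (size (good_tree d h c u))%:R) c0 =
  h%:R * expect (words d M) F c0.
Proof.
elim: h u F => [|h IH] u F uM iF.
  rewrite mul0r (_ : (fun c => _) = fun=> 0) ?expect_cst //.
  by apply/funext => c; rewrite mulr0.
rewrite (_ : (fun c => _) = fun c => F c + \sum_(i < d)
    (F c * (c u <= i)%:R) * (size (good_tree d h c (i :: u)))%:R); last first.
  apply/funext => c; rewrite size_good_treeS -add1n natrD mulrDr mulr1 natr_sum big_distrr /=.
  by congr +%R; apply: eq_bigr => i _; case: ifP => _; rewrite ?mulr1 ?mulr0 ?mul0r.
rewrite expectD expect_sum.
rewrite (eq_bigr (fun i : 'I_d => h%:R * (expect (words d M) F c0 *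
    \sum_(j < d.+1) r j * (j <= i)%:R))).
  rewrite -!big_distrr /= mean_children -add1n natrD; ring.
move=> i _; rewrite IH; last 2 first.
- by move=> /=; lia.
- move=> y c j; rewrite -cat_rcons iF /upd ifN //.
  by apply/eqP => /(congr1 size); rewrite size_cat size_rcons; lia.
congr (_ * _); rewrite (@expect_indep u _ _ (fun a => (a <= i)%:R)) 1?mulrC //.
- by rewrite mem_words; lia.
- exact: (iF [::]).
Qed.

(** The iterates at 0 of the generating function of the offspring law. *)
Fixpoint extinct_prob h : R :=
  if h is h'.+1 then \sum_(j < d.+1) r j * extinct_prob h' ^+ (d - j) else 0.

(** The subtrees of distinct children use disjoint sets of rotors, so their indicators can be
    replaced by their means one at a time. The assumption on [h] is the induction hypothesis of
    [expect_extinct]. *)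
Lemma expect_prod_extinct M h u (l : seq 'I_d) F c0 : uniq l ->
  (size u + h < M)%N ->
  (forall v G, (size v + h <= M)%N -> (forall y, indep (y ++ v) G) ->
     expect (words d M) (fun c => G c * (extinct d h c v)%:R) c0 =
     extinct_prob h * expect (words d M) G c0) ->
  (forall y i, i \in l -> indep (y ++ i :: u) F) ->
  expect (words d M) (fun c => F c *
    \prod_(i <- l) if (c u <= i)%N then (extinct d h c (i :: u))%:R else 1) c0 =
  expect (words d M) (fun c => F c *
    \prod_(i <- l) if (c u <= i)%N then extinct_prob h else 1) c0.
Proof.
move=> + uM IH; elim: l F => [|i l IHl] F /=.
  by move=> _ _; congr (expect _ _ c0); apply/funext => c; rewrite !big_nil.
move=> /andP[il ul] iF.
have cu c y i' j : upd d c (y ++ i' :: u) j u = c u.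
  by rewrite /upd ifN //; apply/eqP => /(congr1 size); rewrite size_cat /=; lia.
pose P c := \prod_(i <- l) if (c u <= i)%N then extinct_prob h else 1.
transitivity (expect (words d M) (fun c => (F c * P c) *
    if (c u <= i)%N then (extinct d h c (i :: u))%:R else 1) c0).
  rewrite -[RHS]/(expect (words d M) (fun c => _) c0).
  transitivity (expect (words d M) (fun c =>
     (F c * if (c u <= i)%N then (extinct d h c (i :: u))%:R else 1) * P c) c0).
    rewrite -IHl //.
      by congr (expect _ _ c0); apply/funext => c; rewrite big_cons mulrA.
    move=> y i' il' c j; rewrite iF ?in_cons ?il' ?orbT // cu; congr (_ * _).
    case: ifP => // _; congr (nat_of_bool _)%:R; apply: extinct_ext => z _.
    rewrite /upd; case: eqP => // /cons_cat_inj ii; by rewrite ii il' in il.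
  by congr (expect _ _ c0); apply/funext => c; rewrite mulrAC.
(* Splitting on whether child [i] is good moves the condition into the independent factor, so that
   [IH] applies to the first summand. *)
transitivity (expect (words d M) (fun c =>
    F c * P c * (c u <= i)%N%:R * (extinct d h c (i :: u))%:R
    + F c * P c * (~~ (c u <= i)%N)%:R) c0).
  congr (expect _ _ c0); apply/funext => c.
  by case: (c u <= i)%N => /=; ring.
rewrite expectD IH /=; last 2 first.
- by lia.
- move=> y c j; rewrite /P cu iF ?mem_head //.
rewrite -[X in X + _]/((fun c => _ * expect _ _ c) c0) -expectZ.
rewrite -[LHS]/((fun c => expect _ _ c + expect _ _ c) c0).
rewrite -expectD; congr (expect _ _ c0); apply/funext => c.
by rewrite /P big_cons; case: (c u <= i)%N => /=; ring.
Qed.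

Lemma expect_extinct M h u F c0 : (size u + h <= M)%N ->
  (forall y, indep (y ++ u) F) ->
  expect (words d M) (fun c => F c * (extinct d h c u)%:R) c0 =
  extinct_prob h * expect (words d M) F c0.
Proof.
elim: h u F => [|h IH] u F uM iF.
  rewrite mul0r (_ : (fun c => _) = fun=> 0) ?expect_cst //.
  by apply/funext => c; rewrite mulr0.
rewrite (_ : (fun c => _) = fun c => F c * \prod_(i <- enum 'I_d)
   if (c u <= i)%N then (extinct d h c (i :: u))%:R else 1); last first.
  apply/funext => c; congr (_ * _); rewrite big_enum /=.
  case: forallP => [e|ne].
    rewrite big1 // => i _; case: ifP => // ci; by have /implyP -> := e i.
  have [i] : exists i : 'I_d, ~~ ((c u <= i)%N ==> extinct d h c (i :: u)).
    by apply/existsP; rewrite -negb_forall; apply/forallP.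
  rewrite negb_imply => /andP[ci /negbTE ei].
  by rewrite (bigD1 i) //= ci ei mul0r.
rewrite expect_prod_extinct ?enum_uniq //; last 2 first.
- by lia.
- by move=> y i _; rewrite -cat_rcons.
rewrite (@expect_indep u _ _ (fun a => \prod_(i <- enum 'I_d)
   if (a <= i)%N then extinct_prob h else 1)).
- congr (_ * _); apply: eq_bigr => j _; congr (_ * _); rewrite big_enum /=.
  exact: prod_leq_ord.
- by rewrite mem_words; lia.
- exact: (iF [::]).
Qed.

Lemma extinct_prob01 h : 0 <= extinct_prob h <= 1.
Proof.
elim: h => [|h /andP[q0 q1]] /=; first by rewrite lexx ler01.
rewrite sumr_ge0 => [|j _]; last by rewrite mulr_ge0 // exprn_ge0.
rewrite -r_sum ler_sum // => j _; rewrite ler_piMr //.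
exact: exprn_ile1.
Qed.

Lemma extinct_prob_cvg e : r d.-1 < 1 -> 0 < e -> exists h, 1 - extinct_prob h < e.
Proof.
move=> r1 e0; pose p h := 1 - extinct_prob h.
have p01 h : 0 <= p h <= 1 by have := extinct_prob01 h; rewrite /p; lra.
pose b := \sum_(j < d.+1) r j * (j + 2 <= d)%:R.
have b0 : 0 < b.
  (* Here [b] is the probability of at least two good children. As the mean is one, the probability
     [r d] of no good child equals the mean excess over one, at most (d - 1) b; so 1 - r (d - 1) = r
     d + b is at most d b. *)
  have le : 1 - r d.-1 <= d.+1%:R * b.
    have [d' dE] : exists d', d = d'.+2 by exists d.-2; lia.
    have rj (j : nat) : (j <= d)%N -> 0 <= r j.
      by move=> jd; have := r_ge0 (Ordinal (jd : (j < d.+1)%N)).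
    have := r_sum; have := r_mean; rewrite /b {b p01 p}.
    move: rj; rewrite dE !big_ord_recr /= => rj.
    have -> : \sum_(i < d') r i * (i + 2 <= d'.+2)%N%:R = \sum_(i < d') r i.
      by apply: eq_bigr => j _; rewrite addn2 !ltnS ltnW ?ltn_ord ?mulr1.
    have s0 : 0 <= \sum_(j < d') r j.
      by apply: sumr_ge0 => j _; apply: rj; have := ltn_ord j; lia.
    have m0 : 0 <= \sum_(j < d') j%:R * r j.
      by apply: sumr_ge0 => j _; rewrite mulr_ge0 // rj //; have := ltn_ord j; lia.
    move: (\sum_(j < d') r j) (\sum_(j < d') j%:R * r j) s0 m0 => s m s0 m0.
    have [-> -> ->] : [/\ (d' + 2 <= d'.+2)%N, (d'.+1 + 2 <= d'.+2)%N = false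
      & (d'.+2 + 2 <= d'.+2)%N = false] by split; lia.
    have rd : 0 <= r d' by apply: rj; lia.
    rewrite subn1 /= -[d'.+3]addn3 -[d'.+2]addn2 -[d'.+1]addn1 !natrD.
    have a0 : 0 <= d'%:R :> R by [].
    move: (d'%:R : R) a0 => a a0 mean sum.
    have := congr1 ( *%R a) sum; have := mulr_ge0 a0 s0; have := mulr_ge0 a0 rd.
    by lra.
  have : 0 < d.+1%:R * b by lra.
  by rewrite pmulr_rgt0 // ltr0n.
(* Bernoulli's inequality with a quadratic gain gives p (h+1) <= p h - b (p h)^2
   for the survival probability p, whence n b (p n)^2 <= 1. *)
have bern (x : R) m : 0 <= x <= 1 ->
    1 - m%:R * x + (2 <= m)%N%:R * x ^+ 2 <= (1 - x) ^+ m.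
  move=> /andP[x0 x1]; case: m => [|[|m]]; first by rewrite expr0 /=; lra.
    by rewrite expr1 /=; lra.
  rewrite mul1r; elim: m => [|m IH]; first by rewrite !expr2; nra.
  rewrite exprS; apply: (@le_trans _ _ ((1 - x) * (1 - m.+2%:R * x + x ^+ 2))).
    have a1 : 1 <= m.+2%:R :> R by rewrite ler1n.
    rewrite -[m.+3]addn1 natrD; move: (m.+2%:R : R) a1 => a a1.
    have ax : 0 <= a - x by lra.
    by have := mulr_ge0 (exprn_ge0 2 x0) ax; rewrite !expr2 expr1; lra.
  by rewrite ler_wpM2l // subr_ge0.
have step h : p h.+1 <= p h - b * p h ^+ 2.
  suff : 1 - p h + b * p h ^+ 2 <= extinct_prob h.+1.
    by rewrite [p h.+1]/p; move: (extinct_prob h.+1) (p h) => ? ?; lra.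
  rewrite [X in X <= _](_ : _ = \sum_(j < d.+1) r j *
      (1 - (d - j)%:R * p h + (2 <= d - j)%N%:R * p h ^+ 2)).
    rewrite ler_sum // => j _; rewrite ler_wpM2l //.
    by have := bern (p h) (d - j)%N (p01 h); rewrite {4}/p subKr.
  transitivity (\sum_(j < d.+1) (r j - r j * (d - j)%:R * p h
      + r j * (j + 2 <= d)%N%:R * p h ^+ 2)).
    by rewrite big_split sumrB /= -!mulr_suml r_sum mean_offspring mul1r.
  apply: eq_bigr => j _; have -> : (2 <= d - j)%N = (j + 2 <= d)%N by lia.
  by ring.
have bound n : n%:R * (b * p n ^+ 2) <= 1 - p n.
  elim: n => [|n IH]; first by rewrite mul0r; have := p01 0; lra.
  have p1 := p01 n; have p2 := p01 n.+1; have st := step n.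
  have le : p n.+1 ^+ 2 <= p n ^+ 2.
    by rewrite lerXn2r ?nnegrE //; [lra|lra|nra].
  rewrite -natr1 mulrDl mul1r.
  have : n%:R * (b * p n.+1 ^+ 2) <= n%:R * (b * p n ^+ 2).
    by rewrite ler_wpM2l // ler_wpM2l // ltW.
  have : b * p n.+1 ^+ 2 <= b * p n ^+ 2 by rewrite ler_wpM2l // ltW.
  lra.
have be : 0 < b * e ^+ 2 by rewrite mulr_gt0 // exprn_gt0.
(* This [n] exceeds 1 / (b e^2), which [bound] forbids if [p n] is at least [e]. *)
exists (Num.truncn (b * e ^+ 2)^-1).+1; set n := _.+1.
rewrite ltNge; apply/negP => le.
have : n%:R * (b * e ^+ 2) <= 1.
  apply: (le_trans _ (le_trans (bound n) _)); last by have := p01 n; lra.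
  by rewrite ler_wpM2l // ler_wpM2l ?(ltW b0) // lerXn2r ?nnegrE ?(ltW e0) //; have := p01 n; lra.
rewrite leNgt => /negP; apply; rewrite -ltr_pdivrMr // mul1r.
exact: truncnS_gt.
Qed.

End Expectation.
Arguments expect {R d} r s F c.
Arguments indep {R d} v F.
Arguments extinct_prob {R} d r h.

(** * Chebyshev estimate for the growth of the range *)

Section SecondMoment.
Variables (R : realType) (d : nat) (r : nat -> R).
Hypothesis r_sum : \sum_(j < d.+1) r j = 1.
Hypothesis r_ge0 : forall j : 'I_d.+1, 0 <= r j.
Hypothesis r_mean : \sum_(j < d.+1) j%:R * r j = (d - 1)%:R.
Hypothesis d_ge2 : (2 <= d)%N.
Implicit Types (c : config d) (u v x y : vertex d) (h k n : nat).

(* For a set A closed under taking ancestors, it is enough to look at length n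
   to know that all words of A have length < n. *)
Definition confined n (A : pred (vertex d)) : bool :=
  all [pred x | (size x == n) ==> ~~ A x] (words d n.+1).

Lemma confinedP n c k :
  reflect (forall x, size x = n -> (k <= bad_edges d c x)%N)
          (confined n (range_set d c k)).
Proof.
apply: (iffP allP) => [H x sx|H x _].
  have /implyP := H x ltac:(by rewrite mem_words sx).
  by rewrite sx eqxx /range_set -leqNgt; apply.
by apply/implyP => /eqP /H; rewrite /range_set -leqNgt.
Qed.

(** The boundary of a set confined below level [n] can reach level [n] itself, hence [n.+1]. *)
Definition boundary_card n (A : pred (vertex d)) : nat :=
  \sum_(u <- words d n.+1) boundary d A u.

(** The exceptional event of the Chebyshev bound. The level [n] makes it depend on finitely many
    rotors. *)
Definition slow_growth k n h c : bool :=
  confined n (range_set d c k) &&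
  (2 * \sum_(u <- words d n.+1 | boundary d (range_set d c k) u)
     size (good_tree d h c u) <= h * boundary_card n (range_set d c k))%N.

Lemma boundary_card_gt_range k n c : (0 < k)%N -> confined n (range_set d c k) ->
  (\sum_(x <- words d n) range_set d c k x < boundary_card n (range_set d c k))%N.
Proof.
move=> k0 /confinedP fin; have := @boundary_count d c k n k0 fin.
by rewrite /boundary_card; nia.
Qed.

(** Fewer than [k] edges cannot contain [k] bad ones, so the range contains all words shorter than
    [k], at least 2^k - 1 of them; the boundary is strictly larger. *)
Lemma boundary_card_ge k n c : (0 < k)%N -> confined n (range_set d c k) ->
  (2 ^ k <= boundary_card n (range_set d c k))%N.
Proof.
move=> k0 fin; apply: leq_trans (boundary_card_gt_range _ _ _ k0 fin).
apply: leq_trans (size_words d k d_ge2) _; rewrite ltnS sum_size_filter.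
apply: uniq_leq_size (uniq_words d k) _ => x; rewrite mem_words mem_filter mem_words => xk.
have i0 : 'I_d by exists 0%N; lia.
have kn : (k <= n)%N.
  move/confinedP: fin => /(_ (nseq n i0)); rewrite size_nseq => /(_ erefl).
  by move/leq_trans; apply; rewrite -[X in (_ <= X)%N](size_nseq n i0) bad_edges_le_size.
by rewrite /range_set (leq_ltn_trans (bad_edges_le_size _ _ _) xk) (leq_trans xk kn).
Qed.

Lemma max_size_ge h : (h <= max_size d h)%N.
Proof. by elim: h => //= h IH; nia. Qed.

(** The boundary is itself random, so the squared deviation is weighted by [w], the inverse square
    of its size, inside the expectation. The cross terms vanish; the diagonal terms add up to at
    most the square of [max_size h] over the boundary size, which is at least 2^k. *)
Lemma expect_slow_growth k n h c0 : (0 < k)%N -> (0 < h)%N ->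
  expect r (words d (n.+1 + h)) (fun c => (slow_growth k n h c)%:R) c0 <=
  4 * (max_size d h)%:R ^+ 2 / 2 ^+ k.
Proof.
move=> k0 h0; move ME: (n.+1 + h)%N => M; set V := words d n.+1.
pose A c := range_set d c k.
pose w (B : pred (vertex d)) : R :=
  (confined n B)%:R / (boundary_card n B)%:R ^+ 2.
pose Z u c : R := (boundary d (A c) u)%:R * ((size (good_tree d h c u))%:R - h%:R).
pose ms : R := (max_size d h)%:R.
have Ln0 c : confined n (A c) -> 0 < (boundary_card n (A c))%:R :> R.
  move=> fin; rewrite ltr0n; apply: leq_trans (boundary_card_ge _ _ _ k0 fin).
  by rewrite expn_gt0.
(* Chebyshev: the deviation of the sum from its mean h * boundary_card is at
   least half of that mean. *)
have markov c : (slow_growth k n h c)%:R <= 4 * (w (A c) * (\sum_(u <- V) Z u c) ^+ 2).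
  rewrite /slow_growth -/(A c); case: andP => [[fin le]|_]; last first.
    by rewrite mulr0n mulr_ge0 // mulr_ge0 ?sqr_ge0 // /w divr_ge0 // sqr_ge0.
  have L0 := Ln0 c fin.
  have -> : \sum_(u <- V) Z u c =
      (\sum_(u <- V | boundary d (A c) u) size (good_tree d h c u))%N%:R
      - h%:R * (boundary_card n (A c))%:R.
    rewrite /boundary_card natr_sum natr_sum big_distrr /= [X in X - _]big_mkcond -sumrB.
    by apply: eq_bigr => u _; rewrite /Z; case: ifP => _ /=; ring.
  move: le; rewrite -(ler_nat R) !natrM /w fin.
  move: ((\sum_(u <- V | boundary d (A c) u) size (good_tree d h c u))%N%:R : R).
  move: ((boundary_card n (A c))%:R : R) L0 => L L0 S le.
  have h1 : 1 <= h%:R :> R by rewrite ler1n.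
  rewrite mul1r mulrCA -[X in X <= _](mulVf (lt0r_neq0 (exprn_gt0 2 L0))).
  rewrite ler_wpM2l ?invr_ge0 ?sqr_ge0 //.
  have : L <= h%:R * L by rewrite ler_peMl // ltW.
  move: (h%:R * L) le => a le La.
  have b1 : 0 <= 2 * (a - S) - L by lra.
  have b2 : 0 <= 2 * (a - S) + L by lra.
  by have := mulr_ge0 b1 b2; rewrite !expr2; lra.
(* When u and u' are both on the boundary, the rotors in the subtree of u affect
   neither the range nor the tree at u', and the tree at u has mean size h. *)
have cross u u' : u \in V -> u' \in V -> u != u' ->
    expect r (words d M) (fun c => w (A c) * (Z u c * Z u' c)) c0 = 0.
  rewrite !mem_words => uV u'V uu'.
  pose F c := w (A c) * Z u' c * (boundary d (A c) u)%:R.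
  have iF y : indep (y ++ u) F.
    move=> c j; rewrite /F; case: (leqP k (bad_edges d c u)) => ku.
      rewrite /Z /A range_set_upd //.
      case bu : (boundary d (range_set d c k) u); rewrite ?mulr0 //.
      case bu' : (boundary d (range_set d c k) u'); rewrite ?mul0r ?mulr0 ?mul0r //.
      congr (_ * (_ * ((size _)%:R - _)) * _); apply: good_tree_ext => z _.
      rewrite /upd; case: eqP => // /esym e.
      by move: uu'; rewrite (boundary_incomparable _ _ _ _ _ _ _ bu bu' e) eqxx.
    (* In the remaining case [u] lies in the range both before and after the update, and [F]
       vanishes in both configurations. *)
    have outside c' : (bad_edges d c' u < k)%N -> boundary d (A c') u = false.
      by rewrite /boundary /A {1}/range_set => ->.
    rewrite (outside c) // (outside (upd _ _ _ _)) ?mulr0 //.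
    by rewrite ltnNge le_bad_edges_upd -ltnNge.
  rewrite (_ : (fun c => _) = fun c => F c * (size (good_tree d h c u))%:R
      + - h%:R * F c); last by apply/funext => c; rewrite /F {1}/Z; ring.
  rewrite expectD expectZ (expect_good_tree _ _ _ r_sum r_mean d_ge2) //; first by ring.
  by lia.
apply: (le_trans (expect_le _ _ _ r_ge0 _ _ _ c0 markov)).
rewrite expectZ -mulrA ler_wpM2l // -/ms.
rewrite (_ : (fun c => _) = fun c => \sum_(u <- V) \sum_(u' <- V) w (A c) * (Z u c * Z u' c)).
  rewrite expect_sum.
  apply: (@le_trans _ _ (\sum_(u <- V) expect r (words d M)
      (fun c => ms ^+ 2 * (w (A c) * (boundary d (A c) u)%:R)) c0)).
    rewrite big_seq [X in _ <= X]big_seq ler_sum // => u uV.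
    rewrite expect_sum (bigD1_seq u) ?uniq_words //= big1_seq ?addr0; last first.
      by move=> u' /andP[uu' u'V]; apply: cross => //; rewrite eq_sym.
    apply: (expect_le R d r r_ge0) => c.
    rewrite /Z; case: boundary; last by rewrite !mul0r !mulr0.
    rewrite !mul1r mulr1 mulrC ler_wpM2r //.
      by rewrite /w divr_ge0 // sqr_ge0.
    have : (size (good_tree d h c u))%:R <= ms by rewrite ler_nat size_good_tree.
    have : h%:R <= ms by rewrite ler_nat max_size_ge.
    have : 0 <= h%:R :> R by [].
    have : 0 <= (size (good_tree d h c u))%:R :> R by [].
    by rewrite !expr2; nra.
  rewrite -[X in X <= _]/((fun c => \sum_(u <- V) expect r (words d M)
    (fun c => ms ^+ 2 * (w (A c) * (boundary d (A c) u)%:R)) c) c0) -expect_sum.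
  rewrite -[X in _ <= X]/((fun=> ms ^+ 2 / 2 ^+ k) c0).
  rewrite -[X in _ <= X c0](expect_cst _ _ _ r_sum (words d M)).
  apply: expect_le => // c.
  rewrite -big_distrr /= ler_wpM2l ?sqr_ge0 // -big_distrr /=.
  rewrite -natr_sum -/(boundary_card n (A c)) /w.
  case fin : (confined n (A c)); last by rewrite !mul0r invr_ge0 exprn_ge0.
  have L0 := Ln0 c fin; rewrite mul1r expr2 invfM -mulrA mulVf ?lt0r_neq0 // mulr1.
  rewrite lef_pV2 ?posrE ?exprn_gt0 // -natrX ler_nat.
  exact: boundary_card_ge.
apply/funext => c; rewrite expr2 big_distrlr /= big_distrr /=.
by apply: eq_bigr => u _; rewrite big_distrr.
Qed.

End SecondMoment.

(** * Almost sure statements *)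

Lemma sum_words_widen d (f : vertex d -> nat) n m : (n <= m)%N ->
  (forall u, (n <= size u)%N -> f u = 0%N) ->
  (\sum_(u <- words d m) f u = \sum_(u <- words d n) f u)%N.
Proof.
move=> nm f0; rewrite (bigID (fun u : vertex d => size u < n)%N) /= [X in (_ + X)%N]big1.
  rewrite addn0 -big_filter; apply/perm_big/uniq_perm.
  - by rewrite filter_uniq // uniq_words.
  - exact: uniq_words.
  - move=> x; rewrite mem_filter !mem_words; case: ltnP => //= xn.
    exact: leq_trans xn nm.
by move=> u; rewrite -leqNgt => /f0.
Qed.

Section Almost_sure.
Variables (R : realType) (dT : measure_display) (T : measurableType dT).
Variables (P : probability T R) (d : nat) (r : nat -> R) (rho : vertex d -> T -> 'I_d.+1).
Hypothesis d_ge2 : (2 <= d)%N.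
Hypothesis measurable_rho :
  forall (v : vertex d) (j : 'I_d.+1), measurable [set w | rho v w = j].
Hypothesis iid_rho : forall (s : seq (vertex d)) (f : vertex d -> 'I_d.+1), uniq s ->
  P (\big[setI/setT]_(v <- s) [set w | rho v w = f v]) =
  (\prod_(v <- s) r (nat_of_ord (f v)))%:E.

Definition rotors w : config d := fun v => nat_of_ord (rho v w).

Definition depends_on (s : seq (vertex d)) (B : config d -> bool) :=
  forall c c', {in s, c =1 c'} -> B c = B c'.

(** The rotors on [t] are revealed, those on [s] are not. The induction reveals the head of [s] and
    splits the event by its value; once [s] is empty, [B] is decided by [f] and the product formula
    remains. *)
Lemma probability_cylinder s t (f : vertex d -> 'I_d.+1) B :
  uniq (s ++ t) -> depends_on (s ++ t) B ->
  let E := [set w | (forall v, v \in t -> rho v w = f v) /\ B (rotors w)] in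
  measurable E /\
  P E = ((\prod_(v <- t) r (f v)) *
         expect r s (fun c => (B c)%:R) (fun v => f v))%:E.
Proof.
elim: s t f => [|v s IH] t f /= us Bs.
  have -> : [set w | (forall v, v \in t -> rho v w = f v) /\ B (rotors w)] =
     if B (fun v => f v) then \big[setI/setT]_(v <- t) [set w | rho v w = f v] else set0.
    rewrite -bigcap_seq; case: ifPn => [Bf|/negP Bf]; apply/seteqP; split=> w //=.
    - by case.
    - move=> H; split=> //; rewrite (Bs _ (fun v => f v)) // => v vt.
      by rewrite /rotors H.
    - case=> H Bw; apply: Bf; rewrite (Bs _ (rotors w)) // => v vt.
      by rewrite /rotors H.
  case: ifP => _; last by rewrite mulr0 measure0.
  by rewrite mulr1 iid_rho //; split=> //; apply: bigsetI_measurable.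
have pst : perm_eq (s ++ v :: t) (v :: s ++ t) by rewrite (perm_catCA s [:: v] t).
have ust : uniq (s ++ v :: t) by rewrite (perm_uniq pst).
have vt : v \notin t by move: us; rewrite mem_cat negb_or => /andP[/andP[]].
pose f' (j : 'I_d.+1) x := if x == v then j else f x.
have Bst : depends_on (s ++ v :: t) B.
  by move=> c c' e; apply: Bs => x xs; apply: e; rewrite (perm_mem pst).
pose E j := [set w | (forall x, x \in v :: t -> rho x w = f' j x) /\ B (rotors w)].
have -> : [set w | (forall v, v \in t -> rho v w = f v) /\ B (rotors w)] =
    \big[setU/set0]_(j < d.+1) E j.
  rewrite -bigcup_mkord_ord; apply/seteqP; split=> w /=.
    move=> [H Bw]; exists (rho v w) => //=; rewrite inord_val; split=> // x.
    rewrite in_cons /f'; case: eqP => [-> //|_ /=]; exact: H.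
  move=> [j _ /= [H Bw]]; split=> // x xt.
  rewrite H ?in_cons ?xt ?orbT // /f' ifN //.
  by apply: contraNneq vt => <-.
have mE j : measurable (E j) := (IH (v :: t) (f' j) ust Bst).1.
have PE j : P (E j) = _ := (IH (v :: t) (f' j) ust Bst).2.
have mU : measurable (\big[setU/set0]_(j < d.+1) E j) by apply: bigsetU_measurable.
split => //.
rewrite measure_semi_additive_ord //; last first.
  move=> i j _ _ [w [[Hi _] [Hj _]]].
  have := Hi v (mem_head _ _); have := Hj v (mem_head _ _).
  by rewrite /f' eqxx => -> ->.
rewrite (eq_bigr (fun j : 'I_d.+1 => ((\prod_(x <- t) r (f x)) * (r j *
   expect r s (fun c => (B c)%:R) (upd d (fun v => f v) v j)))%:E)).
  by rewrite sumEFin -big_distrr.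
move=> j _; transitivity ((\prod_(x <- v :: t) r (f' j x)) *
  expect r s (fun c => (B c)%:R) (fun x => f' j x))%:E; first exact: PE.
rewrite big_cons /f' eqxx; congr EFin.
have -> : (fun x => nat_of_ord (if x == v then j else f x)) = upd d (fun v => f v) v j.
  by apply/funext => x; rewrite /upd; case: eqP.
rewrite -mulrA mulrCA; congr (_ * _); apply: eq_big_seq => x xt.
by rewrite ifN //; apply: contraNneq vt => <-.
Qed.

Lemma probability_event s B : uniq s -> depends_on s B ->
  measurable [set w | B (rotors w)] /\
  P [set w | B (rotors w)] = (expect r s (fun c => (B c)%:R) (fun=> 0%N))%:E.
Proof.
move=> us Bs; have := @probability_cylinder s [::] (fun=> ord0) B.
rewrite cats0 big_nil mul1r => /(_ us Bs).
rewrite (_ : [set w | _ /\ _] = [set w | B (rotors w)]) //.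
by apply/seteqP; split=> w /= => [[]|].
Qed.

Lemma rotor_law_ge0 (j : 'I_d.+1) : 0 <= r j.
Proof.
have := @iid_rho [:: [::]] (fun=> j) isT; rewrite !big_seq1 => e.
by rewrite -lee_fin -e.
Qed.

Lemma rotor_law_sum : \sum_(j < d.+1) r j = 1.
Proof.
have := (@probability_event [:: [::]] xpredT isT (fun _ _ _ => erefl)).2.
rewrite (_ : [set w | _] = setT); last by apply/seteqP; split.
rewrite probability_setT /= => -[] /=; rewrite /average => ->.
by apply: eq_bigr => j _; rewrite mulr1.
Qed.

Hypothesis r_mean : \sum_(j < d.+1) (nat_of_ord j)%:R * r j = (d - 1)%:R.
Lemma confined_widen n m k c : (n <= m)%N ->
  confined d n (range_set d c k) -> confined d m (range_set d c k).
Proof.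
move=> nm /confinedP H; apply/confinedP => x sx.
rewrite -(cat_take_drop (m - n) x); apply: leq_trans (bad_edges_cat _ _ _ _).
by apply: H; rewrite size_drop; lia.
Qed.

Lemma boundary_outside n k c u : confined d n (range_set d c k) ->
  (n < size u)%N -> boundary d (range_set d c k) u = false.
Proof.
move=> fin; case: u => //= i v; rewrite ltnS => nv.
have /confinedP/(_ v erefl) := confined_widen _ _ _ _ nv fin.
by rewrite /boundary /range_set [X in _ && X]ltnNge => ->; rewrite andbF.
Qed.

Lemma boundary_sum_widen n m k c (f : vertex d -> nat) : (n <= m)%N ->
  confined d n (range_set d c k) ->
  (\sum_(u <- words d m.+1 | boundary d (range_set d c k) u) f u =
   \sum_(u <- words d n.+1 | boundary d (range_set d c k) u) f u)%N.
Proof.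
move=> nm fin; rewrite big_mkcond [RHS]big_mkcond; apply: sum_words_widen => // u nu.
by rewrite (boundary_outside n).
Qed.

(** Makes the events increase with [n], so that the probability of their union is a limit. *)
Lemma slow_growth_widen n m k h c : (n <= m)%N ->
  slow_growth d k n h c -> slow_growth d k m h c.
Proof.
move=> nm /andP[fin le]; rewrite /slow_growth (confined_widen n) //=.
have sum1 p : boundary_card d p (range_set d c k)
    = (\sum_(u <- words d p.+1 | boundary d (range_set d c k) u) 1)%N.
  by rewrite /boundary_card [RHS]big_mkcond.
by move: le; rewrite !sum1 !(boundary_sum_widen n m).
Qed.

(** Boundary vertices have length at most [n], and their trees reach fewer than [h] levels
    further. *)
Lemma depends_slow_growth k n h :
  depends_on (words d (n.+1 + h)) (slow_growth d k n h).
Proof.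
move=> c c' e.
have ce v : (size v < n.+1 + h)%N -> c v = c' v by move=> sv; apply: e; rewrite mem_words.
have be x : (size x <= n.+1)%N -> range_set d c k x = range_set d c' k x.
  move=> sx; rewrite /range_set (@bad_edges_ext _ c c') // => v vx.
  exact: ce (leq_trans vx (leq_trans sx (leq_addr _ _))).
have bde u : u \in words d n.+1 ->
    boundary d (range_set d c k) u = boundary d (range_set d c' k) u.
  rewrite mem_words /boundary => su; rewrite be; last by lia.
  by case: u su => //= i v sv; rewrite be //; lia.
rewrite /slow_growth /confined /boundary_card; congr (_ && (2 * _ <= _ * _))%N.
- by apply: eq_in_all => x; rewrite mem_words /= => sx; rewrite be //; lia.
- rewrite big_mkcond [RHS]big_mkcond; apply: eq_big_seq => u uV.
  rewrite bde //; case: ifP => // _; congr size; apply: good_tree_ext => y sy.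
  by apply: ce; move: uV; rewrite mem_words size_cat addnC => su; exact: leq_add su (ltnW sy).
- by apply: eq_big_seq => u uV; rewrite bde.
Qed.

(** The Chebyshev bound is uniform in [n], so it passes to the union over [n]. It is summable in
    [k], and Borel-Cantelli applies for each of the countably many [h]. The successors supply the
    positivity of [k] and [h]. *)
Lemma ae_fast_growth : {ae P, forall w, forall h, exists K, forall k, (K <= k)%N ->
  forall n, ~~ slow_growth d k.+1 n h.+1 (rotors w)}.
Proof.
apply: ae_foralln => h.
pose F k n := [set w | slow_growth d k.+1 n h.+1 (rotors w)].
have ev k n := probability_event _ _ (uniq_words _ _) (depends_slow_growth k.+1 n h.+1).
have mU k : measurable (\bigcup_n F k n).
  by apply: bigcup_measurable => n _; exact: (ev k n).1.
pose C : R := 4 * (max_size d h.+1)%:R ^+ 2.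
have le k : (P (\bigcup_n F k n) <= (C / (2 ^ (k + 1))%:R)%:E)%E.
  have cv : (P \o F k) n @[n --> \oo] --> P (\bigcup_n F k n).
    apply: nondecreasing_cvg_mu => //; first by move=> n; exact: (ev k n).1.
    by move=> n m nm; apply/subsetPset => w /=; exact: slow_growth_widen.
  apply: (cvge_to_le cv); apply: nearW => n /=.
  rewrite /F (ev k n).2 lee_fin natrX addn1.
  exact: (expect_slow_growth _ _ _ rotor_law_sum rotor_law_ge0 r_mean d_ge2).
have null : P (lim_sup_set (fun k => \bigcup_n F k n)) = 0%E.
  apply: lim_sup_set_cvg0 => //.
  apply: (@le_lt_trans _ _ (\sum_(0 <= k <oo) (C / (2 ^ (k + 1))%:R)%:E)%E).
    by apply: lee_nneseries => k _ => [_|]; [exact: measure_ge0|exact: le].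
  have /cvg_lim -> // := @cvg_geometric_eseries_half R C 0.
  by rewrite ltry.
exists (lim_sup_set (fun k => \bigcup_n F k n)); split => //.
  by apply: bigcap_measurable => // n _; apply: bigcup_measurable => k _.
move=> w /= H K _; apply: contrapT => N; apply: H; exists K => k Kk n.
by apply/negP => sg; apply: N; exists k => //; exists n.
Qed.

Hypothesis r_lt1 : r d.-1 < 1.

(** There are countably many vertices, so one [u] suffices; survival for ever has probability at
    most [1 - extinct_prob h] for every [h]. *)
Lemma ae_extinct : {ae P, forall w, forall u, exists h, extinct d h (rotors w) u}.
Proof.
have aeu u : {ae P, forall w, exists h, extinct d h (rotors w) u}.
  have dep h : depends_on (words d (size u + h)) (fun c => extinct d h c u).
    move=> c c' e; apply: extinct_ext => y ly; apply: e.
    by rewrite mem_words size_cat; lia.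
  have mE h := (probability_event _ _ (uniq_words _ _) (dep h)).1.
  pose A := \bigcap_h ~` [set w | extinct d h (rotors w) u].
  have mA : measurable A by apply: bigcap_measurable => // h _; exact: measurableC.
  exists A; split=> //; last first.
    by move=> w /= H h _ /= e; apply: H; exists h.
  apply/eqP; rewrite eq_le measure_ge0 andbT; apply/lee_addgt0Pr => e e0.
  have [h lt] := extinct_prob_cvg _ _ _ rotor_law_sum rotor_law_ge0 r_mean d_ge2 e r_lt1 e0.
  apply: (@le_trans _ _ (P (~` [set w | extinct d h (rotors w) u]))).
    apply: le_measure; rewrite ?inE //; first exact: measurableC.
    by apply: bigcap_inf.
  rewrite probability_setC // (probability_event _ _ (uniq_words _ _) (dep h)).2.
  have -> : expect r (words d (size u + h)) (fun c => (extinct d h c u)%:R) (fun=> 0%N)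
     = extinct_prob d r h.
    rewrite (_ : (fun c => _) = fun c => 1 * (extinct d h c u)%:R); last first.
      by apply/funext => c; rewrite mul1r.
    rewrite (expect_extinct _ _ _ rotor_law_sum d_ge2) //.
    by rewrite expect_cst ?mulr1 //; exact: rotor_law_sum.
  by rewrite add0e -EFinB lee_fin ltW.
(* Vertices are enumerated by [unpickle]; numbers that code no vertex are sent to the root. *)
have : {ae P, forall w, forall n : nat,
    exists h, extinct d h (rotors w) (odflt [::] (unpickle n))}.
  by apply: ae_foralln => n; exact: aeu.
by apply: filterS => w H u; have := H (pickle u); rewrite pickleK.
Qed.

End Almost_sure.

(** The last term of [S k] eventually dwarfs the sum of the earlier ones, so the ratio behaves like
    a / (2 a). *)
Lemma superexponential_ratio (R : realType) (a : nat -> nat)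
    (S := fun k => (\sum_(1 <= i < k.+1) a i)%N) :
  (forall k, (0 < a k.+1)%N) ->
  (forall h, exists K, forall k, (K <= k)%N -> (h * a k.+1 <= 2 * a k.+2)%N) ->
  (fun k => (a k)%:R / ((S k).*2.-1)%:R : R) @ \oo --> (2^-1 : R).
Proof.
move=> a0 grow.
have SS k : S k.+1 = (S k + a k.+1)%N by rewrite /S big_nat_recr.
have S0 k : (0 < S k.+1)%N by rewrite SS ltn_addl.
have [B [K0 bound]] : exists B K0, forall k, (K0 <= k)%N -> (S k.+1 <= B * a k.+1)%N.
  have [K0 gK0] := grow 4.
  (* From [K0] on the terms at least double, and a geometric sum is at most twice its last term;
     [S K0.+1] pays for the start. *)
  exists (2 + S K0.+1)%N, K0 => k /subnK <-.
  elim: (k - K0)%N => [|i IH]; first by rewrite add0n; have := a0 K0; nia.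
  rewrite addSn SS; have := gK0 (i + K0)%N (leq_addl _ _); nia.
have small m : exists K, forall k, (K <= k)%N -> (m * S k.+1 <= a k.+2)%N.
  have [K1 gK1] := grow (2 * (m * B))%N.
  exists (K0 + K1)%N => k Kk.
  have := bound k ltac:(lia); have := gK1 k ltac:(lia).
  rewrite -mulnA leq_pmul2l // -mulnA => le1 le2.
  by apply: leq_trans le1; rewrite leq_mul2l le2 orbT.
apply/cvgrPdist_le => e e0.
have [K small_K] := small (Num.truncn e^-1).+1.
exists K.+2 => // k /= Kk.
have [j kj] : exists j, k = j.+2 by exists k.-2; lia.
rewrite kj in Kk *; have := small_K j ltac:(lia).
have := S0 j; have := a0 j.+1; rewrite (SS j.+1); move: (S j.+1) (a j.+2) => s b b0 s0 le.
have lt : e^-1 < (Num.truncn e^-1).+1%:R by exact: truncnS_gt.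
have {}le : s%:R <= e * b%:R :> R.
  rewrite -ler_pdivrMl //.
  apply: (@le_trans _ _ ((Num.truncn e^-1).+1 * s)%N%:R); last by rewrite ler_nat.
  by rewrite natrM ler_wpM2r // ltW.
have -> : ((s + b).*2.-1)%:R = 2 * (s%:R + b%:R) - 1 :> R.
  by rewrite -subn1 natrB ?double_gt0 ?addn_gt0 ?s0 // -muln2 natrM natrD mulrC.
have s1 : 1 <= s%:R :> R by rewrite ler1n.
have b1 : 1 <= b%:R :> R by rewrite ler1n.
move: (s%:R : R) (b%:R : R) s1 b1 le => x y s1 b1 le.
have D0 : 0 < 2 * (x + y) - 1 by lra.
have -> : 2^-1 - y / (2 * (x + y) - 1) = (x - 2^-1) / (2 * (x + y) - 1).
  by field; lra.
rewrite ger0_norm; last by rewrite divr_ge0 //; lra.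
rewrite ler_pdivrMr //; nra.
Qed.

Theorem theorem3p3 (R : realType) (dT : measure_display) (T : measurableType dT)
  (P : probability T R) (d : nat) (r : nat -> R)
  (rho : vertex d -> T -> 'I_d.+1) :
  (2 <= d)%N ->
  (* each rho(v) is a random variable *)
  (forall (v : vertex d) (j : 'I_d.+1), measurable [set w | rho v w = j]) ->
  (* the rho(v) are i.i.d. with P[rho(v) = j] = r_j *)
  (forall (s : seq (vertex d)) (f : vertex d -> 'I_d.+1), uniq s ->
     P (\big[setI/setT]_(v <- s) [set w | rho v w = f v]) =
     (\prod_(v <- s) r (nat_of_ord (f v)))%:E) ->
  (* null recurrence: E[rho(v)] = d - 1 and r_{d-1} < 1 *)
  \sum_(j < d.+1) (nat_of_ord j)%:R * r j = (d - 1)%:R ->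
  r d.-1 < 1 ->
  {ae P, forall w : T,
     let c0 : config d := fun v => nat_of_ord (rho v w) in
     exists tau : nat -> nat,
       tau 0 = 0%N /\
       (forall k, (0 < k)%N -> is_kth_return c0 k (tau k)) /\
       (fun k => (range_size c0 (tau k))%:R / (tau k)%:R : R) @ \oo --> (2^-1 : R)}.
Proof.
move=> d2 mrho iid mean r1.
have fast := ae_fast_growth _ _ _ _ _ _ _ d2 mrho iid mean.
apply: (filterS2 _ _ (ae_extinct _ _ _ _ _ _ _ d2 mrho iid mean r1) fast).
move=> w ext {}fast; pose c0 := rotors _ _ d rho w; rewrite -/c0 in ext fast.
rewrite -[fun v : vertex d => _]/c0.
have cd x : (c0 x <= d)%N by rewrite -ltnS ltn_ord.
have /choice[N finN] := range_finite d c0 ext.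
have ret k := return_time d c0 N cd finN k.
(* For [k = 0] the truncated predecessor of [restart 0 = 0] is 0, as [tau 0] requires. *)
exists (fun k => (restart d c0 N k).-1); split; first by rewrite /restart big_geq.
split; first by move=> k /ret[].
apply: (@cvg_trans _ ((fun k => (range_card d c0 N k)%:R
    / (restart d c0 N k).-1%:R : R) @ \oo)).
  apply: near_eq_cvg; exists 1%N => // k /= k0.
  by rewrite (ret k k0).2.
apply: superexponential_ratio => [k|h].
  rewrite /range_card sum_size_filter -has_predT; apply/hasP; exists [::] => //.
  by rewrite mem_range_words.
(* At level [N k.+1] the range is confined, so [slow_growth] can fail only because the new trees are
   large compared with the boundary, which outnumbers the range. *)
have [K fK] := fast h; exists K => k /fK /(_ (N k.+1)).
have fin : confined d (N k.+1) (range_set d c0 k.+1) by apply/confinedP; exact: finN.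
rewrite /slow_growth fin andTb -ltnNge => lt.
have := boundary_card_gt_range d d2 _ _ _ (ltn0Sn _) fin.
rewrite -/(range_card d c0 N k.+1) => gt.
have := sum_good_trees d c0 k.+1 h.+1 (N k.+1).+1.
have : (\sum_(x <- words d ((N k.+1).+1 + h.+1)) range_set d c0 k.+2 x
    <= range_card d c0 N k.+2)%N.
  rewrite /range_card !sum_size_filter uniq_leq_size ?filter_uniq ?uniq_words // => x.
  by rewrite mem_range_words // mem_filter => /andP[].
move=> le1 le2; have := leq_trans le2 le1; nia.
Qed.
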